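(* Let $n\ge 2$, $d\ge 1$, $E=\mathbb{R}^d$, $\alpha>0$, and let $m_1,\dots,m_n>0$ with $\sum_{j=1}^n m_j=1$. Let $C^1$, $Z^1$, $\delta^0$, $P_m$, $X$, $U$ and the mass-norm $\|\cdot\|_M$ be as defined in the context. (1) Central configurations, normalized by scaling so as to be critical points of $U(\mathbf{x})+\|\mathbf{x}\|_M^2$ on $\mathbb{F}_n(E)$ (equivalently, so that the constant $\lambda$ in the central configuration equation equals $-2$), correspond via the isomorphism $\delta^0|_X$ exactly to the critical points of the restriction to the space of $1$-cocycles $Z^1\subset C^1$ of the partially defined function $C^1\to\mathbb{R}$, $$\mathbf{q}\mapsto \sum_{1\le i<j\le n} m_i m_j\left(|\mathbf{q}_{ij}|^{-\alpha}+|\mathbf{q}_{ij}|^2\right),$$ which is defined where $\mathbf{q}_{ij}\ne \mathbf{0}$ for all $i<j$. That is, $\mathbf{x}\in X$ is a critical point of $U+\|\cdot\|_M^2$ if and only if $\delta^0(\mathbf{x})$ is a critical point of this restricted function. (2) A cochain $\mathbf{q}\in C^1$ with $\mathbf{q}_{ij}\neq \mathbf{0}$ for all $i\ne j$ is a central configuration (i.e. $\mathbf{q}=\delta^0(\mathbf{x})$ for some central configuration $\mathbf{x}\in X$) if and only if there exists $\lambda\in\mathbb{R}$ such that $$\lambda\,\mathbf{q}=P_m(\mathbf{Q}),\qquad\text{where } \mathbf{Q}_{ij}=\frac{\mathbf{q}_{ij}}{|\mathbf{q}_{ij}|^{\alpha+2}}\ \text{ for all } i\neq j ,$$ and $P_m:C^1\to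 Z^1\subset C^1$ is the orthogonal projection of $C^1$ onto the space of $1$-cocycles defined in the context.
   Context: $|\cdot|$ is the Euclidean norm on $E$. $\mathbb{F}_n(E)=\{\mathbf{x}=(\mathbf{x}_1,\dots,\mathbf{x}_n)\in E^n:\mathbf{x}_i\ne\mathbf{x}_j \text{ for } i\ne j\}$, with mass-norm $\|\mathbf{x}\|_M^2=\sum_j m_j|\mathbf{x}_j|^2$, and $U(\mathbf{x})=\sum_{1\le i<j\le n} m_im_j|\mathbf{x}_i-\mathbf{x}_j|^{-\alpha}$. A central configuration is $\mathbf{x}\in\mathbb{F}_n(E)$ for which there is $\lambda\in\mathbb{R}$ with $\lambda m_j\mathbf{x}_j=\frac{\partial U}{\partial \mathbf{x}_j}$ for all $j=1,\dots,n$. $X=\{\mathbf{x}\in\mathbb{F}_n(E):\sum_j m_j\mathbf{x}_j=\mathbf{0}\}$. $C^0=E^n$. $C^1$ is the vector space of families $\mathbf{q}=(\mathbf{q}_{ij})_{1\le i,j\le n}$ with $\mathbf{q}_{ij}\in E$, $\mathbf{q}_{ij}=-\mathbf{q}_{ji}$ (so $\mathbf{q}_{ii}=\mathbf{0}$), i.e. simplicial $1$-cochains with coefficients in $E$ of the standard simplex with vertices $1,\dots,n$. The coboundary is $\delta^0:C^0\to C^1$, $\delta^0(\mathbf{x})_{ij}=\mathbf{x}_j-\mathbf{x}_i$. The space of $1$-cocycles is $Z^1=\{\mathbf{q}\in C^1:\mathbf{q}_{ij}+\mathbf{q}_{jk}+\mathbf{q}_{ki}=\mathbf{0}\ \text{for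 all } i,j,k\}=\operatorname{Im}\delta^0$. The map $\delta^0$ restricts to a linear isomorphism from $\{\mathbf{x}\in E^n:\sum_j m_j\mathbf{x}_j=\mathbf{0}\}$ onto $Z^1$; its restriction to $X$ is denoted $\delta^0|_X$ and has image the set of cocycles with $\mathbf{q}_{ij}\neq\mathbf{0}$ for $i\ne j$. The linear map $P_m:C^1\to C^1$ is defined for $i\ne j$ by $(P_m(\mathbf{Q}))_{ij}=\sum_{k\notin\{i,j\}} m_k(\mathbf{Q}_{ik}+\mathbf{Q}_{kj}+\mathbf{Q}_{ji})+\mathbf{Q}_{ij}$; it is the projection of $C^1$ onto $Z^1$ orthogonal with respect to the scalar product $\langle\mathbf{v},\mathbf{w}\rangle_M=\sum_{i<j}m_im_j\,\mathbf{v}_{ij}\cdot\mathbf{w}_{ij}$.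
   Formalization: In (2), λ is required to be nonzero: with λ=0 allowed the claim fails, e.g. n=3, d=1, m_i=1/3, q_12=q_23=q_31=1 gives P_m(Q)=0 although q is not a cocycle. *)

(* Defs.v *)
From HB Require Import structures.
From mathcomp Require Import all_boot all_order all_algebra.
From mathcomp Require Import all_classical all_reals all_analysis.

Set Implicit Arguments.
Unset Strict Implicit.
Unset Printing Implicit Defensive.

Import Order.TTheory GRing.Theory Num.Theory.
Import numFieldNormedType.Exports.

Local Open Scope classical_set_scope.
Local Open Scope ring_scope.

(* The library norm on matrices is the sup norm.  Here it only provides the
   (norm-independent) differential calculus on the finite-dimensional spaces
   E^n and C^1; the Euclidean norm of E = 'rV[R]_d is [enorm]. *)
Definition enorm (R : realType) (d : nat) (v : 'rV[R]_d) : R :=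
  Num.sqrt (\sum_(k < d) v 0 k ^+ 2).

(* Critical point, at x, of the restriction of f to the linear subspace W:
   the tangent space of W at x is W, and the differential of the restriction
   is the restriction of 'd f x.  With W = setT this is a critical point of f
   on any open set containing x. *)
Definition critical_along (R : realType) (V : normedModType R) (W : set V)
    (f : V -> R) (x : V) : Prop :=
  differentiable f x /\ forall v : V, W v -> 'd f x v = 0.

(* A configuration in E^n is the matrix x whose j-th row is x_j. *)

Definition Fn (R : realType) (n d : nat) : set 'M[R]_(n, d) :=
  [set x | forall i j : 'I_n, i != j -> row i x != row j x].

Definition X (R : realType) (n d : nat) (m : 'I_n -> R) : set 'M[R]_(n, d) :=
  [set x | Fn x /\ \sum_(j < n) m j *: row j x = 0].

Definition mass_sqnorm (R : realType) (n d : nat) (m : 'I_n -> R)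
    (x : 'M[R]_(n, d)) : R :=
  \sum_(j < n) m j * enorm (row j x) ^+ 2.

(* Since powR is total, this also has a value at collisions; only its values on
   the open set Fn are ever used. *)
Definition U (R : realType) (n d : nat) (alpha : R) (m : 'I_n -> R)
    (x : 'M[R]_(n, d)) : R :=
  \sum_(i < n) \sum_(j < n | (i < j)%N)
    m i * m j * enorm (row i x - row j x) `^ (- alpha).

(* The vector of E of partial derivatives with respect to the coordinates of
   the j-th body. *)
Definition partial_grad (R : realType) (n d : nat) (f : 'M[R]_(n, d) -> R)
    (j : 'I_n) (x : 'M[R]_(n, d)) : 'rV[R]_d :=
  \row_(k < d) 'D_(delta_mx j k) f x.

Definition cc_equation (R : realType) (n d : nat) (alpha : R) (m : 'I_n -> R)
    (lambda : R) (x : 'M[R]_(n, d)) : Prop :=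
  forall j : 'I_n, (lambda * m j) *: row j x = partial_grad (U alpha m) j x.

Definition central_configuration (R : realType) (n d : nat) (alpha : R)
    (m : 'I_n -> R) (x : 'M[R]_(n, d)) : Prop :=
  Fn x /\ exists lambda : R, cc_equation alpha m lambda x.

Definition critical_Fn (R : realType) (n d : nat) (alpha : R)
    (m : 'I_n -> R) : set 'M[R]_(n, d) :=
  [set x | Fn x /\
    critical_along setT (fun y => U alpha m y + mass_sqnorm m y) x].

(* A family (q_ij) of vectors of E is stored as a matrix of type
   'M[R]_(n * n, d), which carries a normed module structure: q_ij is its row
   of index [mxvec_index i j]. *)
Definition entry (R : realType) (n d : nat) (q : 'M[R]_(n * n, d))
    (i j : 'I_n) : 'rV[R]_d :=
  row (mxvec_index i j) q.

Definition family_mx (R : realType) (n d : nat)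
    (F : 'I_n -> 'I_n -> 'rV[R]_d) : 'M[R]_(n * n, d) :=
  \matrix_(p < n * n, k < d) mxvec (\matrix_(i < n, j < n) F i j 0 k) 0 p.

Lemma entryE (R : realType) (n d : nat) (F : 'I_n -> 'I_n -> 'rV[R]_d) i j :
  entry (family_mx F) i j = F i j.
Proof. by apply/rowP => k; rewrite !mxE mxvecE mxE. Qed.

Lemma entryP (R : realType) (n d : nat) (p q : 'M[R]_(n * n, d)) :
  (forall i j, entry p i j = entry q i j) <-> p = q.
Proof.
split=> [pq|-> //]; apply/row_matrixP => s.
by case/mxvec_indexP: s => i j; apply: pq.
Qed.

Definition C1 (R : realType) (n d : nat) : set 'M[R]_(n * n, d) :=
  [set q | forall i j : 'I_n, entry q i j = - entry q j i].

Definition Z1 (R : realType) (n d : nat) : set 'M[R]_(n * n, d) :=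
  [set q | C1 q /\
    forall i j k : 'I_n, entry q i j + entry q j k + entry q k i = 0].

Definition delta0 (R : realType) (n d : nat) (x : 'M[R]_(n, d)) :
    'M[R]_(n * n, d) :=
  family_mx (fun i j => row j x - row i x).

Definition nonvanishing (R : realType) (n d : nat) (q : 'M[R]_(n * n, d)) :
    Prop :=
  forall i j : 'I_n, i != j -> entry q i j != 0.

(* On C^1 the formula gives 0 when i = j. *)
Definition Pm (R : realType) (n d : nat) (m : 'I_n -> R)
    (Q : 'M[R]_(n * n, d)) : 'M[R]_(n * n, d) :=
  family_mx (fun i j =>
    \sum_(k < n | (k != i) && (k != j))
      m k *: (entry Q i k + entry Q k j + entry Q j i) + entry Q i j).

(* Q_ij = q_ij / |q_ij|^(alpha + 2); this is 0 when i = j and q is in C^1. *)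
Definition Qcochain (R : realType) (n d : nat) (alpha : R)
    (q : 'M[R]_(n * n, d)) : 'M[R]_(n * n, d) :=
  family_mx (fun i j =>
    (enorm (entry q i j) `^ (alpha + 2))^-1 *: entry q i j).

Definition cochain_potential (R : realType) (n d : nat) (alpha : R)
    (m : 'I_n -> R) (q : 'M[R]_(n * n, d)) : R :=
  \sum_(i < n) \sum_(j < n | (i < j)%N)
    m i * m j * (enorm (entry q i j) `^ (- alpha) + enorm (entry q i j) ^+ 2).

Definition critical_Z1 (R : realType) (n d : nat) (alpha : R)
    (m : 'I_n -> R) : set 'M[R]_(n * n, d) :=
  [set q | [/\ Z1 q, nonvanishing q &
    critical_along (@Z1 R n d) (cochain_potential alpha m) q]].

(* Main.v *)
(* Let div : C^1 -> E^n be the adjoint of delta0 for the mass scalar products,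
   (div Q)_j = sum_i m_i Q_ij.  Because the masses sum to 1, div inverts delta0
   on centered configurations, and P_m = delta0 o div.  Summation by parts gives
   grad U(x) = (- alpha m_j (div Q)_j)_j with Q_ij = q_ij / |q_ij|^(alpha + 2),
   q = delta0 x, so both the central configuration equation and the criticality
   of x or of delta0 x become lambda x = - alpha div Q (with lambda = - 2 for
   critical points).  Applying delta0 or div passes between this equation and
   P_m Q = (- lambda / alpha) q. *)
Require Import Defs.
From HB Require Import structures.
From mathcomp Require Import all_boot all_order all_algebra.
From mathcomp Require Import all_classical all_reals all_analysis.
From mathcomp Require Import ring lra.

Import Order.TTheory GRing.Theory Num.Theory.
Import numFieldNormedType.Exports.

Local Open Scope classical_set_scope.
Local Open Scope ring_scope.

(** * Scalar product and norm on E *)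

Definition dot {R : realType} {d : nat} (u v : 'rV[R]_d) : R :=
  \sum_(k < d) u 0 k * v 0 k.

Lemma dotC {R : realType} {d : nat} (u v : 'rV[R]_d) : dot u v = dot v u.
Proof. by apply: eq_bigr => k _; rewrite mulrC. Qed.

Lemma dotDl {R : realType} {d : nat} (u v w : 'rV[R]_d) :
  dot (u + v) w = dot u w + dot v w.
Proof. by rewrite -big_split; apply: eq_bigr => k _; rewrite !mxE mulrDl. Qed.

Lemma dotZl {R : realType} {d : nat} (a : R) (u v : 'rV[R]_d) :
  dot (a *: u) v = a * dot u v.
Proof. by rewrite mulr_sumr; apply: eq_bigr => k _; rewrite !mxE mulrA. Qed.

Lemma dotNl {R : realType} {d : nat} (u v : 'rV[R]_d) :
  dot (- u) v = - dot u v.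
Proof. by rewrite -scaleN1r dotZl mulN1r. Qed.

Lemma dotBr {R : realType} {d : nat} (u v w : 'rV[R]_d) :
  dot u (v - w) = dot u v - dot u w.
Proof. by rewrite dotC dotDl dotNl !(dotC _ u). Qed.

Lemma dot0l {R : realType} {d : nat} (v : 'rV[R]_d) : dot 0 v = 0.
Proof. by rewrite -(scale0r 0) dotZl mul0r. Qed.

Lemma dot_suml {R : realType} {d : nat} {I : Type} (r : seq I) (P : pred I)
    (F : I -> 'rV[R]_d) (v : 'rV[R]_d) :
  dot (\sum_(i <- r | P i) F i) v = \sum_(i <- r | P i) dot (F i) v.
Proof.
by elim/big_rec2: _ => [|i y1 y2 _ <-]; rewrite ?dot0l ?dotDl.
Qed.

Lemma dot_ge0 {R : realType} {d : nat} (v : 'rV[R]_d) : 0 <= dot v v.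
Proof. by apply: sumr_ge0 => k _; rewrite -expr2 sqr_ge0. Qed.

Lemma dot_gt0 {R : realType} {d : nat} (v : 'rV[R]_d) : (0 < dot v v) = (v != 0).
Proof.
rewrite lt0r dot_ge0 andbT; congr negb; apply/idP/eqP => [/eqP v0|->].
  apply/rowP => k; rewrite mxE; apply/eqP; rewrite -sqrf_eq0; apply/eqP.
  rewrite expr2.
  by apply: (psumr_eq0P _ v0) => // i _; rewrite -expr2 sqr_ge0.
by rewrite dot0l.
Qed.

Lemma enormE {R : realType} {d : nat} (v : 'rV[R]_d) :
  enorm v = Num.sqrt (dot v v).
Proof. by congr Num.sqrt; apply: eq_bigr => k _; rewrite expr2. Qed.

Lemma enorm_sqr {R : realType} {d : nat} (v : 'rV[R]_d) :
  enorm v ^+ 2 = dot v v.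
Proof. by rewrite enormE sqr_sqrtr ?dot_ge0. Qed.

Lemma enorm_gt0 {R : realType} {d : nat} (v : 'rV[R]_d) :
  (0 < enorm v) = (v != 0).
Proof. by rewrite enormE sqrtr_gt0 dot_gt0. Qed.

Lemma enorm_ge0 {R : realType} {d : nat} (v : 'rV[R]_d) : 0 <= enorm v.
Proof. exact: sqrtr_ge0. Qed.

Lemma enormN {R : realType} {d : nat} (v : 'rV[R]_d) : enorm (- v) = enorm v.
Proof. by rewrite !enormE dotNl dotC dotNl opprK. Qed.

(** Trades powers of the norm for powers of the quadratic form [dot v v], so that the square root
    never has to be differentiated. *)
Lemma enorm_powR {R : realType} {d : nat} (a : R) (v : 'rV[R]_d) :
  enorm v `^ a = dot v v `^ (a / 2).
Proof. by rewrite enormE -powR12_sqrt ?dot_ge0// -powRrM mulrC. Qed.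

Lemma enormZ {R : realType} {d : nat} (c : R) (v : 'rV[R]_d) :
  enorm (c *: v) = `|c| * enorm v.
Proof.
by rewrite !enormE dotZl dotC dotZl mulrA -expr2 sqrtrM ?sqr_ge0// sqrtr_sqr.
Qed.

(** * Differential calculus for powers of norms *)

Section Differentials.
Context {R : realType} {V : normedModType R}.

Lemma is_diff_ext (f g df dg : V -> R) (x : V) :
  f =1 g -> df =1 dg -> is_diff x f df -> is_diff x g dg.
Proof. by move=> /funext <- /funext <-. Qed.

Lemma is_diff_sum {I : Type} (r : seq I) (P : pred I) (f df : I -> V -> R)
    (x : V) :
  (forall i, P i -> is_diff x (f i) (df i)) ->
  is_diff x (fun y => \sum_(i <- r | P i) f i y)
    (fun v => \sum_(i <- r | P i) df i v).
Proof.
move=> fd; elim: r => [|i r IH].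
  rewrite (_ : (fun y => _) = cst 0); last by apply/funext => y; rewrite big_nil.
  by apply: is_diff_eq; apply/funext => v; rewrite big_nil.
have [Pi|Pi] := boolP (P i).
  rewrite (_ : (fun y => _) = f i + (fun y => \sum_(i <- r | P i) f i y)).
    have := fd _ Pi => fi.
    apply: is_diff_eq; apply/funext => v; by rewrite big_cons Pi.
  by apply/funext => y; rewrite big_cons Pi.
rewrite (_ : (fun y => _) = (fun y => \sum_(i <- r | P i) f i y)).
  apply: is_diff_eq; apply/funext => v; by rewrite big_cons (negbTE Pi).
by apply/funext => y; rewrite big_cons (negbTE Pi).
Qed.

(** The hypothesis makes each coordinate of [f] its own differential, as for a continuous linear
    [f]; the uses are rows of configurations and entries of cochains. *)
Lemma is_diff_dot {d : nat} (f : V -> 'rV[R]_d) (x : V) :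
  (forall k, is_diff x (fun y => f y 0 k) (fun v => f v 0 k)) ->
  is_diff x (fun y => dot (f y) (f y)) (fun v => 2 * dot (f x) (f v)).
Proof.
move=> fd; rewrite /dot.
apply: is_diff_eq.
  apply: (is_diff_sum _ _ (fun k y => f y 0 k * f y 0 k)
     (fun k v => f x 0 k *: f v 0 k + f x 0 k *: f v 0 k)) => k _.
  have := fd k => fk.
  by apply: (@is_diffM _ _ (fun y => f y 0 k) (fun y => f y 0 k)).
apply/funext => v; rewrite mulr_sumr; apply: eq_bigr => k _ /=.
by rewrite mulr_natl mulr2n.
Qed.

Lemma is_diff_powR (f df : V -> R) (a : R) (x : V) :
  is_diff x f df -> 0 < f x ->
  is_diff x (fun y => f y `^ a) (fun v => a * f x `^ (a - 1) * df v).
Proof.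
move=> fd fx.
have [] := is_derive1_powR a fx => /derivable1_diffP gd gD.
apply: (is_diff_eq (is_diff_comp fd (differentiableP gd))).
apply/funext => v /=.
rewrite diff1E// derive1E gD; exact: mulrC.
Qed.

(** Chain rule for (f . f)^(-a/2): the exponent -a/2 - 1 = -(a + 2)/2 produces the weight |f|^-(a +
    2) of [Qcochain]. *)
Lemma is_diff_enorm_powRN {d : nat} (a : R) (f : V -> 'rV[R]_d) (x : V) :
  (forall k, is_diff x (fun y => f y 0 k) (fun v => f v 0 k)) -> f x != 0 ->
  is_diff x (fun y => enorm (f y) `^ (- a))
    (fun v => - a * ((enorm (f x) `^ (a + 2))^-1 * dot (f x) (f v))).
Proof.
move=> fd fx.
rewrite (_ : (fun y => _) = (fun y => dot (f y) (f y) `^ (- a / 2))); last first.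
  by apply/funext => y; rewrite enorm_powR.
have fd' := is_diff_dot f x fd.
have := is_diff_powR _ _ (- a / 2) _ fd'; rewrite dot_gt0 => /(_ fx) D.
apply: (is_diff_eq D).
apply/funext => v; rewrite enorm_powR -powRN.
have -> : - ((a + 2) / 2) = - a / 2 - 1 by field.
by field.
Qed.

Lemma is_diffDr (f df g dg : V -> R) (x : V) :
  is_diff x f df -> is_diff x g dg ->
  is_diff x (fun y => f y + g y) (fun v => df v + dg v).
Proof. exact: is_diffD. Qed.

Lemma is_diffZr (f df : V -> R) (k : R) (x : V) :
  is_diff x f df -> is_diff x (fun y => k * f y) (fun v => k * df v).
Proof. by move=> fd; apply: (@is_diffZ _ _ _ f df k x). Qed.

End Differentials.

Lemma is_diff_coord {R : realType} {p q : nat} (x : 'M[R]_(p, q)) i k :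
  is_diff x (fun y : 'M[R]_(p, q) => y i k) (fun v => v i k).
Proof.
split; first exact: differentiable_coord.
pose f (y : 'M[R]_(p, q)) : R := y i k.
have lf : linear f by move=> a u v; rewrite /f !mxE.
pose L := GRing.isLinear.Build _ _ _ _ f lf.
pose F : {linear 'M[R]_(p, q) -> R} := HB.pack f L.
by apply: (@diff_lin _ _ _ F); exact: coord_continuous.
Qed.

(** * Summation by parts over pairs *)

Lemma sum_offdiag {R : realType} {n : nat} (B : 'I_n -> 'I_n -> R) :
  (forall i, B i i = 0) ->
  \sum_(i < n) \sum_(j < n) B i j =
  \sum_(i < n) \sum_(j < n | (i < j)%N) (B i j + B j i).
Proof.
move=> B0.
under [RHS]eq_bigr do rewrite big_split.
rewrite big_split /= [X in _ + X](exchange_big_dep predT)//= -big_split /=.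
apply: eq_bigr => i _.
rewrite (bigID (fun j : 'I_n => (i < j)%N)) /=; congr (_ + _).
rewrite (bigID (fun j : 'I_n => j == i)) /= big1 ?add0r; last first.
  by move=> j /andP[_ /eqP ->].
by apply: eq_bigl => j; rewrite -leqNgt ltn_neqAle andbC.
Qed.

(** Antisymmetry gives A_ij . (w_j - w_i) = A_ij . w_j + A_ji . w_i, so the sum over i < j unfolds
    into the full double sum of m_i m_j A_ij . w_j, whose diagonal vanishes. *)
Lemma sum_pairs {R : realType} {n d : nat} (m : 'I_n -> R)
    (A : 'I_n -> 'I_n -> 'rV[R]_d) (w : 'I_n -> 'rV[R]_d) :
  (forall i j, A i j = - A j i) ->
  \sum_(i < n) \sum_(j < n | (i < j)%N)
    m i * m j * dot (A i j) (w j - w i) =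
  \sum_(j < n) m j * dot (\sum_(i < n) m i *: A i j) (w j).
Proof.
move=> AN.
have A0 i : A i i = 0.
  by apply/rowP => k; have /rowP/(_ k) := AN i i; rewrite !mxE; lra.
transitivity (\sum_(i < n) \sum_(j < n) m i * m j * dot (A i j) (w j)).
  rewrite sum_offdiag; last by move=> i; rewrite A0 dot0l mulr0.
  apply: eq_bigr => i _; apply: eq_bigr => j _.
  by rewrite dotBr (AN j i) dotNl; ring.
rewrite exchange_big /=; apply: eq_bigr => j _.
rewrite dot_suml mulr_sumr; apply: eq_bigr => i _.
by rewrite dotZl; ring.
Qed.

(** Nondegeneracy of the mass scalar product: testing against x itself leaves a vanishing sum of
    nonnegative terms. *)
Lemma row_sumdot_eq0 {R : realType} {n d : nat} (m : 'I_n -> R)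
    (x : 'M[R]_(n, d)) :
  (forall j, 0 < m j) ->
  (forall v : 'M[R]_(n, d), \sum_(j < n) m j * dot (row j x) (row j v) = 0) ->
  x = 0.
Proof.
move=> hm /(_ x) x0; apply/row_matrixP => j; rewrite row0.
have /eqP : m j * dot (row j x) (row j x) = 0.
  by apply: (psumr_eq0P _ x0) => // i _; rewrite mulr_ge0 ?dot_ge0 ?ltW.
rewrite mulf_eq0 gt_eqF//= => /eqP xj0.
by apply/eqP; rewrite -[_ == _]negbK -dot_gt0 xj0 ltxx.
Qed.

Lemma rowZ {R : realType} {p q : nat} i (a : R) (x : 'M[R]_(p, q)) :
  row i (a *: x) = a *: row i x.
Proof. exact: linearZ. Qed.

Lemma scaleNr_eq {R : realType} {V : lmodType R} (a : R) (x y : V) :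
  (- a *: x = y) <-> (y + a *: x = 0).
Proof.
rewrite scaleNr; split=> [<-|/eqP]; first by rewrite addNr.
by rewrite addr_eq0 => /eqP ->.
Qed.

(** * Cochains, the divergence and the projection [Pm] *)

Section Cochains.
Context {R : realType} {n d : nat}.
Implicit Types (q Q : 'M[R]_(n * n, d)) (x : 'M[R]_(n, d)) (m : 'I_n -> R).

Lemma entryD q Q i j : entry (q + Q) i j = entry q i j + entry Q i j.
Proof. exact: raddfD. Qed.

Lemma entryZ a q i j : entry (a *: q) i j = a *: entry q i j.
Proof. exact: linearZ. Qed.

Lemma entry_diag q i : C1 q -> entry q i i = 0.
Proof.
by move=> qN; apply/rowP => k; have /rowP/(_ k) := qN i i; rewrite !mxE; lra.
Qed.

Lemma delta0Z a x : delta0 (a *: x) = a *: delta0 x.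
Proof.
by apply/entryP => i j; rewrite entryZ !entryE !rowZ -scalerBr.
Qed.

Lemma Z1_delta0 x : Z1 (delta0 x).
Proof.
split=> [i j|i j k]; rewrite !entryE; first by rewrite opprB.
by rewrite (addrC (_ - row i x)) !subrKA subrr.
Qed.

Lemma nonvanishing_delta0 x : nonvanishing (delta0 x) <-> Fn x.
Proof.
split=> h i j ij; have := h _ _ ij; rewrite entryE subr_eq0; first by rewrite eq_sym.
by rewrite eq_sym.
Qed.

(* The adjoint of delta0 for the mass scalar products; see sum_pairs_delta0. *)
Definition divergence m Q : 'M[R]_(n, d) :=
  \matrix_(j < n) \sum_(i < n) m i *: entry Q i j.

Lemma row_divergence m Q j :
  row j (divergence m Q) = \sum_(i < n) m i *: entry Q i j.
Proof. exact: rowK. Qed.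

Lemma divergenceZ m a Q : divergence m (a *: Q) = a *: divergence m Q.
Proof.
apply/row_matrixP => j; rewrite rowZ !row_divergence scaler_sumr.
by apply: eq_bigr => i _; rewrite entryZ !scalerA mulrC.
Qed.

Lemma divergenceD m q Q : divergence m (q + Q) = divergence m q + divergence m Q.
Proof.
apply/row_matrixP => j; rewrite linearD /= !row_divergence -big_split.
by apply: eq_bigr => i _; rewrite entryD scalerDr.
Qed.

(** Exchanging the two indices in the double sum of m_j m_i Q_ij reverses its sign. *)
Lemma center_divergence m Q :
  C1 Q -> \sum_(j < n) m j *: row j (divergence m Q) = 0.
Proof.
move=> QN; set S := LHS.
have SE : S = \sum_(j < n) \sum_(i < n) (m j * m i) *: entry Q i j.
  apply: eq_bigr => j _; rewrite row_divergence scaler_sumr.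
  by apply: eq_bigr => i _; rewrite scalerA.
have SN : S = - S.
  rewrite {1}SE exchange_big SE -sumrN; apply: eq_bigr => i _.
  by rewrite -sumrN; apply: eq_bigr => j _; rewrite QN scalerN mulrC.
by apply/rowP => k; have /rowP/(_ k) := SN; rewrite !mxE; lra.
Qed.

(** Row j is the sum of m_i (x_j - x_i); total mass 1 makes it x_j minus the center of mass. *)
Lemma divergence_delta0 m x :
  \sum_(j < n) m j = 1 -> \sum_(j < n) m j *: row j x = 0 ->
  divergence m (delta0 x) = x.
Proof.
move=> m1 x0; apply/row_matrixP => j; rewrite row_divergence.
under eq_bigr do rewrite entryE scalerBr.
by rewrite big_split /= -scaler_suml m1 scale1r sumrN x0 subr0.
Qed.

(** The cocycle relation gives q_kj - q_ki = q_ij for every k, and averaging over k with weights m_k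
    returns q_ij. *)
Lemma delta0_divergence m q :
  \sum_(j < n) m j = 1 -> Z1 q -> delta0 (divergence m q) = q.
Proof.
move=> m1 [qN qZ]; apply/entryP => i j; rewrite entryE !row_divergence -sumrB.
rewrite -[RHS]scale1r -m1 scaler_suml; apply: eq_bigr => k _.
rewrite -scalerBr; congr (_ *: _).
have /eqP := qZ i j k; rewrite addr_eq0 => /eqP qij.
have -> : entry q i j = - (entry q k i) - entry q j k.
  by apply/eqP; rewrite eq_sym subr_eq eq_sym; apply/eqP.
by rewrite (qN k j) addrC.
Qed.

(** Total mass 1 lets Q_ij be spread over k as m_k Q_ij, which cancels Q_ji in each summand and
    leaves m_k (Q_kj - Q_ki). The indices k = i and k = j omitted from [Pm] fit the same pattern,
    since there Q_kj - Q_ki is Q_ij. *)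
Lemma PmE m Q : \sum_(j < n) m j = 1 -> C1 Q -> Pm m Q = delta0 (divergence m Q).
Proof.
move=> m1 QN; apply/entryP => i j; rewrite !entryE !row_divergence.
have Qij : entry Q i j = \sum_(k < n) m k *: entry Q i j.
  by rewrite -scaler_suml m1 scale1r.
rewrite [X in _ + X]Qij big_mkcond -big_split -sumrB /=; apply: eq_bigr => k _.
rewrite (QN j i) (QN k i); have [->|ki] := eqVneq k i => /=.
  by rewrite entry_diag// oppr0 scaler0 subr0 add0r.
have [->|kj] := eqVneq k j => /=.
  by rewrite entry_diag// scaler0 add0r scalerN opprK add0r.
by rewrite -!scalerDr -scalerBr; congr (_ *: _); rewrite opprK subrK addrC.
Qed.

Lemma C1_Qcochain alpha q : C1 q -> C1 (Qcochain alpha q).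
Proof. by move=> qN i j; rewrite !entryE (qN i j) enormN scalerN. Qed.

(** Homogeneity of degree -(alpha + 1), used to normalize the multiplier by scaling. *)
Lemma QcochainZ alpha c q : 0 < c ->
  Qcochain alpha (c *: q) = ((c `^ (alpha + 2))^-1 * c) *: Qcochain alpha q.
Proof.
move=> c0; apply/entryP => i j; rewrite entryZ !entryE entryZ enormZ.
rewrite gtr0_norm// powRM ?enorm_ge0 ?ltW//.
by rewrite invfM !scalerA; congr (_ *: _); ring.
Qed.

Lemma sum_pairs_delta0 m Q x : C1 Q ->
  \sum_(i < n) \sum_(j < n | (i < j)%N)
    m i * m j * dot (entry Q i j) (entry (delta0 x) i j) =
  \sum_(j < n) m j * dot (row j (divergence m Q)) (row j x).
Proof.
move=> QN; under [RHS]eq_bigr do rewrite row_divergence.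
rewrite -(sum_pairs m _ (fun j => row j x))//.
by apply: eq_bigr => i _; apply: eq_bigr => j _; rewrite entryE.
Qed.

(** * Differentials of the potentials *)

(** A general [f] lets one computation serve both [U], with [f] equal to [delta0], and the cochain
    potential, with [f] the identity. *)
Lemma is_diff_pair_powRN {V : normedModType R} alpha m
    (f : V -> 'M[R]_(n * n, d)) (x : V) :
  (forall p k, is_diff x (fun y => f y p k) (fun v => f v p k)) ->
  nonvanishing (f x) ->
  is_diff x (fun y => \sum_(i < n) \sum_(j < n | (i < j)%N)
      m i * m j * enorm (entry (f y) i j) `^ (- alpha))
    (fun v => \sum_(i < n) \sum_(j < n | (i < j)%N)
      m i * m j * dot (entry (- alpha *: Qcochain alpha (f x)) i j)
                      (entry (f v) i j)).
Proof.
move=> fd fx; apply: is_diff_sum => i _; apply: is_diff_sum => j ij.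
apply: is_diffZr.
have fij : i != j by rewrite -val_eqE /= ltn_eqF.
have := is_diff_enorm_powRN alpha (fun y => entry (f y) i j) x _ (fx _ _ fij).
have fe k : is_diff x (fun y => entry (f y) i j 0 k) (fun v => entry (f v) i j 0 k).
  by apply: is_diff_ext (fd (mxvec_index i j) k) => y; rewrite mxE.
move=> /(_ fe); apply: is_diff_ext => // v.
by rewrite entryZ entryE !dotZl.
Qed.

Lemma is_diff_pair_sqr {V : normedModType R} m
    (f : V -> 'M[R]_(n * n, d)) (x : V) :
  (forall p k, is_diff x (fun y => f y p k) (fun v => f v p k)) ->
  is_diff x (fun y => \sum_(i < n) \sum_(j < n | (i < j)%N)
      m i * m j * enorm (entry (f y) i j) ^+ 2)
    (fun v => \sum_(i < n) \sum_(j < n | (i < j)%N)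
      m i * m j * dot (entry (2 *: f x) i j) (entry (f v) i j)).
Proof.
move=> fd; apply: is_diff_sum => i _; apply: is_diff_sum => j ij.
apply: is_diffZr.
have fe k : is_diff x (fun y => entry (f y) i j 0 k) (fun v => entry (f v) i j 0 k).
  by apply: is_diff_ext (fd (mxvec_index i j) k) => y; rewrite mxE.
apply: is_diff_ext (is_diff_dot _ x fe) => y; first by rewrite enorm_sqr.
by rewrite entryZ dotZl.
Qed.

Lemma is_diff_delta0_coord x p k :
  is_diff x (fun y => delta0 y p k) (fun v => delta0 v p k).
Proof.
case/mxvec_indexP: p => i j.
have coordE (y : 'M[R]_(n, d)) : y j k - y i k = delta0 y (mxvec_index i j) k.
  by have /rowP/(_ k) := entryE (fun i j => row j y - row i y) i j; rewrite !mxE.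
by apply: is_diff_ext (is_diffB (is_diff_coord x j k) (is_diff_coord x i k)).
Qed.

(** [U] is the pair sum pulled back along [delta0]; the adjointness [sum_pairs_delta0] then shows
    that its gradient for the mass scalar product is - alpha div Q. *)
Lemma is_diff_U alpha m x : Fn x ->
  is_diff x (U alpha m) (fun v => \sum_(j < n)
    m j * dot (row j (- alpha *: divergence m (Qcochain alpha (delta0 x)))) (row j v)).
Proof.
move=> /nonvanishing_delta0 x0.
apply: is_diff_ext (is_diff_pair_powRN alpha m (@delta0 R n d) x
  (is_diff_delta0_coord x) x0) => v.
  apply: eq_bigr => i _; apply: eq_bigr => j _.
  (* [U] and [delta0] take opposite differences, but the norm is even. *)
  by rewrite entryE -enormN opprB.
rewrite sum_pairs_delta0 ?divergenceZ// => i j.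
by rewrite !entryZ C1_Qcochain ?scalerN//; case: (Z1_delta0 x).
Qed.

Lemma is_diff_mass_sqnorm m x :
  is_diff x (mass_sqnorm m) (fun v => \sum_(j < n)
    m j * dot (row j (2 *: x)) (row j v)).
Proof.
apply: is_diff_sum => j _; apply: is_diffZr.
have fe k : is_diff x (fun y => row j y 0 k) (fun v => row j v 0 k).
  by apply: is_diff_ext (is_diff_coord x j k) => y; rewrite mxE.
apply: is_diff_ext (is_diff_dot _ x fe) => y; first by rewrite enorm_sqr.
by rewrite rowZ dotZl.
Qed.

Lemma is_diff_cochain_potential alpha m q : nonvanishing q ->
  is_diff q (cochain_potential alpha m) (fun v =>
    \sum_(i < n) \sum_(j < n | (i < j)%N)
      m i * m j * dot (entry (- alpha *: Qcochain alpha q + 2 *: q) i j)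
                      (entry v i j)).
Proof.
move=> q0.
have D1 := is_diff_pair_powRN alpha m id q (is_diff_coord q) q0.
have D2 := is_diff_pair_sqr m id q (is_diff_coord q).
apply: is_diff_ext (is_diffDr _ _ _ _ _ D1 D2) => v; rewrite -big_split /=.
  apply: eq_bigr => i _; rewrite -big_split /=; apply: eq_bigr => j _.
  by rewrite mulrDr.
apply: eq_bigr => i _; rewrite -big_split /=; apply: eq_bigr => j _.
by rewrite -mulrDr entryD dotDl.
Qed.

(** * Central configurations and critical points as solutions of one equation *)

Lemma cc_equationP alpha m lambda x : (forall j, 0 < m j) -> Fn x ->
  cc_equation alpha m lambda x <->
  lambda *: x = - alpha *: divergence m (Qcochain alpha (delta0 x)).
Proof.
move=> hm xF; set D := _ *: divergence _ _.
have gradE j : partial_grad (U alpha m) j x = m j *: row j D.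
  apply/rowP => k; rewrite !mxE.
  have [Ud UE] := is_diff_U alpha m x xF.
  (* Testing the differential on [delta_mx j k] kills every row but j and every coordinate but k. *)
  rewrite deriveE// UE (bigD1 j)//= [X in _ + X]big1 ?addr0 => [|l lj].
    rewrite -/D; congr (_ * _); rewrite /dot (bigD1 k)//= big1 ?addr0 => [|l lk].
      by rewrite !mxE !eqxx mulr1.
    by rewrite !mxE (negbTE lk) andbF mulr0.
  rewrite /dot big1 ?mulr0// => i _.
  by rewrite !mxE (negbTE lj) mulr0.
split=> [h|h j]; last by rewrite gradE -h rowZ scalerA mulrC.
apply/row_matrixP => j; apply: (scalerI (lt0r_neq0 (hm j))).
by rewrite -gradE -h rowZ scalerA mulrC.
Qed.

(** For the mass scalar product the two terms of the function have gradients - alpha div Q and 2 x;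
    the equation says that their sum is zero. *)
Lemma critical_FnP alpha m x : (forall j, 0 < m j) ->
  critical_Fn alpha m x <->
  Fn x /\ - 2 *: x = - alpha *: divergence m (Qcochain alpha (delta0 x)).
Proof.
move=> hm.
suff main : Fn x -> (critical_along setT (fun y => U alpha m y + mass_sqnorm m y) x <->
    - 2 *: x = - alpha *: divergence m (Qcochain alpha (delta0 x))).
  by split=> -[xF /(main xF)].
move=> xF; have [Ed EE] := is_diffDr _ _ _ _ _ (is_diff_U alpha m x xF) (is_diff_mass_sqnorm m x).
set D := _ *: divergence _ _ in EE *.
have dE v : 'd (fun y => U alpha m y + mass_sqnorm m y) x v =
    \sum_(j < n) m j * dot (row j (D + 2 *: x)) (row j v).
  rewrite EE -big_split /=; apply: eq_bigr => j _.
  by rewrite linearD dotDl mulrDr.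
rewrite scaleNr_eq.
split=> [[_ h]|h].
  by apply: (row_sumdot_eq0 m) => // v; rewrite -dE; exact: h.
by split=> // v _; rewrite dE h big1// => j _; rewrite row0 dot0l mulr0.
Qed.

(** Every direction in [Z1] has the form [delta0 v], and adjointness gives the differential there
    the same expression as in [critical_FnP]. Centering of x enters through [divergence_delta0],
    which turns the divergence of 2 q into 2 x. *)
Lemma critical_Z1_delta0 alpha m x : (forall j, 0 < m j) ->
  \sum_(j < n) m j = 1 -> \sum_(j < n) m j *: row j x = 0 -> Fn x ->
  critical_Z1 alpha m (delta0 x) <->
  - 2 *: x = - alpha *: divergence m (Qcochain alpha (delta0 x)).
Proof.
move=> hm m1 x0 xF; set D := _ *: divergence _ _.
have qnv : nonvanishing (delta0 x) by apply/nonvanishing_delta0.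
have [qC qZ] := Z1_delta0 x.
have [Ed EE] := is_diff_cochain_potential alpha m (delta0 x) qnv.
have dE v : 'd (cochain_potential alpha m) (delta0 x) (delta0 v) =
    \sum_(j < n) m j * dot (row j (D + 2 *: x)) (row j v).
  rewrite EE sum_pairs_delta0; last first.
    move=> i j; rewrite !entryD !entryZ (C1_Qcochain _ _ qC i j) (qC i j).
    by rewrite !scalerN opprD.
  by rewrite divergenceD !divergenceZ divergence_delta0.
rewrite scaleNr_eq.
split=> [[_ _ [_ h]]|h].
  apply: (row_sumdot_eq0 m) => // v; rewrite -dE; apply: h.
  exact: Z1_delta0.
split=> //; split=> // q /(delta0_divergence m _ m1) <-.
by rewrite dE h big1// => j _; rewrite row0 dot0l mulr0.
Qed.

(* Euler's homogeneity relation makes lambda |x|^2 = - alpha U negative. *)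
Lemma cc_multiplier_lt0 alpha m lambda x : (2 <= n)%N -> 0 < alpha ->
  (forall j, 0 < m j) -> Fn x ->
  lambda *: x = - alpha *: divergence m (Qcochain alpha (delta0 x)) ->
  lambda < 0.
Proof.
move=> hn a0 hm xF lx.
have [qC _] := Z1_delta0 x.
have qnv : nonvanishing (delta0 x) by apply/nonvanishing_delta0.
have S := sum_pairs_delta0 m _ x (C1_Qcochain alpha _ qC).
set D := divergence _ _ in S lx.
have I_ge0 : 0 <= \sum_(j < n) m j * dot (row j x) (row j x).
  by apply: sumr_ge0 => j _; rewrite mulr_ge0 ?dot_ge0 ?ltW.
have pair_ge0 i j : 0 <=
    m i * m j * dot (entry (Qcochain alpha (delta0 x)) i j) (entry (delta0 x) i j).
  rewrite entryE dotZl; apply: mulr_ge0; first by rewrite ltW ?mulr_gt0.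
  by rewrite mulr_ge0 ?dot_ge0// invr_ge0 powR_ge0.
have S_gt0 : 0 < \sum_(j < n) m j * dot (row j D) (row j x).
  (* The pair of indices 0 and 1, available because n >= 2, contributes strictly; all other pairs
     contribute nonnegatively. *)
  pose i0 := Ordinal (ltnW hn); pose j0 := Ordinal hn.
  rewrite -S (bigD1 i0)//= (bigD1 j0)//= -addrA ltr_pwDl//.
    rewrite [entry (Qcochain _ _) _ _]entryE dotZl !mulr_gt0// ?invr_gt0.
      by rewrite powR_gt0// enorm_gt0; exact: qnv.
    by rewrite dot_gt0; exact: qnv.
  apply: addr_ge0; apply: sumr_ge0 => k _; first exact: pair_ge0.
  by apply: sumr_ge0 => l _; exact: pair_ge0.
have : lambda * \sum_(j < n) m j * dot (row j x) (row j x) =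
    - alpha * \sum_(j < n) m j * dot (row j D) (row j x).
  rewrite !mulr_sumr; apply: eq_bigr => j _.
  have : dot (row j (lambda *: x)) (row j x) = - alpha * dot (row j D) (row j x).
    by rewrite lx rowZ dotZl.
  by rewrite rowZ dotZl => E; rewrite [LHS]mulrCA E mulrCA.
move=> E; rewrite ltNge; apply/negP => l0.
have := mulr_ge0 l0 I_ge0.
by rewrite E mulNr oppr_ge0 leNgt mulr_gt0.
Qed.

End Cochains.

(* In the last item lambda = 0 has to be excluded: for n >= 3 there are
   nonvanishing cochains q outside Z1 with Pm m (Qcochain alpha q) = 0, for
   instance n = 3, d = 1, m_i = 1/3, q_12 = q_23 = q_31 = 1. *)
Theorem theorem2p3 (R : realType) (n d : nat) (alpha : R) (m : 'I_n -> R)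
    (hn : (2 <= n)%N) (hd : (1 <= d)%N) (halpha : 0 < alpha)
    (hm : forall j : 'I_n, 0 < m j) (hm1 : \sum_(j < n) m j = 1) :
  [/\ (forall x : 'M[R]_(n, d), central_configuration alpha m x ->
         exists2 c : R, 0 < c & critical_Fn alpha m (c *: x)),
      (forall x : 'M[R]_(n, d), Fn x ->
         (critical_Fn alpha m x <-> cc_equation alpha m (- 2) x)),
      set_bij (@critical_Fn R n d alpha m) (@critical_Z1 R n d alpha m)
        (@delta0 R n d),
      (forall x : 'M[R]_(n, d), X m x ->
         (critical_Fn alpha m x <-> critical_Z1 alpha m (delta0 x)))
    & (forall q : 'M[R]_(n * n, d), C1 q -> nonvanishing q ->
         ((exists x : 'M[R]_(n, d),
             [/\ X m x, central_configuration alpha m x & q = delta0 x]) <->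
          (exists lambda : R,
             lambda != 0 /\ lambda *: q = Pm m (Qcochain alpha q))))].
Proof.
(* Dividing the critical equation by -2 presents x as a multiple of a divergence, which is
   centered. *)
have centered (x : 'M[R]_(n, d)) : critical_Fn alpha m x -> X m x.
  move=> /critical_FnP -/(_ hm) [xF /(congr1 ( *:%R (- 2)^-1))].
  rewrite scalerA mulVf ?oppr_eq0// scale1r => xE; split=> //.
  have [qC _] := Z1_delta0 x.
  have D0 := center_divergence m _ (C1_Qcochain alpha _ qC).
  rewrite xE; under eq_bigr do rewrite scalerA rowZ scalerA mulrC -scalerA.
  by rewrite -scaler_sumr D0 scaler0.
have crit (x : 'M[R]_(n, d)) : X m x -> (critical_Fn alpha m x <-> critical_Z1 alpha m (delta0 x)).
  move=> [xF x0]; rewrite critical_FnP// critical_Z1_delta0//.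
  by split=> [[]|].
split.
- move=> x [xF [lambda /(cc_equationP _ _ _ _ hm xF) lx]].
  have l0 := cc_multiplier_lt0 _ _ _ _ hn halpha hm xF lx.
  (* Replacing x by c x multiplies the divergence by c / c^(alpha + 2), so the multiplier -2 is
     reached when c^(alpha + 2) = - lambda / 2, a positive number. *)
  pose c := (- lambda / 2) `^ (alpha + 2)^-1.
  have c0 : 0 < c by rewrite powR_gt0//; lra.
  have cE : c `^ (alpha + 2) = - lambda / 2.
    rewrite -powRrM mulVf; last by apply: lt0r_neq0; lra.
    by rewrite powRr1//; lra.
  exists c; [exact: c0 | apply/(critical_FnP _ _ _ hm); split].
    apply/nonvanishing_delta0 => i j ij; rewrite delta0Z entryZ scaler_eq0.
    by rewrite gt_eqF//=; move/nonvanishing_delta0: xF; apply.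
  rewrite delta0Z QcochainZ// divergenceZ [RHS]scalerA [X in _ = X *: _]mulrC.
  rewrite -[RHS]scalerA -lx cE.
  by rewrite !scalerA; congr (_ *: _); field; rewrite lt_eqF.
- by move=> x xF; rewrite critical_FnP// cc_equationP//; split=> [[]|].
- split.
  + by move=> x xc; have [+ _] := crit _ (centered _ xc); exact.
  (* On centered configurations [divergence] is a left inverse of [delta0]. *)
  + move=> x y /set_mem/centered[_ x0] /set_mem/centered[_ y0] xy.
    by rewrite -(divergence_delta0 m x)// xy divergence_delta0.
  + move=> q qc; have [qZ qnv _] := qc.
    have qE := delta0_divergence m q hm1 qZ.
    have dX : X m (divergence m q).
      split; first by apply/nonvanishing_delta0; rewrite qE.
      by apply: center_divergence; case: qZ.
    by exists (divergence m q); [apply/(crit _ dX); rewrite qE | exact: qE].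
- exact: crit.
- move=> q qC qnv; rewrite PmE//; last exact: C1_Qcochain.
  split=> [[x [[xF x0] [_ [lambda lx]] ->]]|[lambda [l0 lq]]].
    move/cc_equationP: lx => /(_ hm xF) lx.
    have l0 := cc_multiplier_lt0 _ _ _ _ hn halpha hm xF lx.
    (* Applying [delta0] to lambda x = - alpha div Q gives lambda q = - alpha P_m Q. *)
    exists (- alpha^-1 * lambda); split.
      apply: mulf_neq0; last by rewrite lt_eqF.
      by rewrite oppr_eq0 invr_eq0 gt_eqF.
    by rewrite -scalerA -!delta0Z lx scalerA mulrNN mulVf ?scale1r// gt_eqF.
  (* Since lambda q = delta0 (div Q) with lambda nonzero, q is the coboundary of this x, although it
     was only assumed to lie in C^1. *)
  pose x := lambda^-1 *: divergence m (Qcochain alpha q).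
  have qE : q = delta0 x by rewrite delta0Z -lq scalerA mulVf// scale1r.
  have xF : Fn x by apply/nonvanishing_delta0; rewrite -qE.
  exists x; split; last exact: qE.
    split; [exact: xF | under eq_bigr do rewrite rowZ scalerA mulrC -scalerA].
    by rewrite -scaler_sumr center_divergence ?scaler0//; exact: C1_Qcochain.
  (* As div Q = lambda x, the multiplier of x is - alpha lambda. *)
  split; [exact: xF | exists (- alpha * lambda); apply/(cc_equationP _ _ _ _ hm xF)].
  by rewrite -qE -scalerA; congr (_ *: _); rewrite scalerA mulfV// scale1r.
Qed.
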